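(* Let $\mathcal{D},\mathcal{D}'$ be division rings and let $m,n,p,q$ be integers $\ge 2$. Let $G(m,m+n;\mathcal{D})$ be the set of $m$-dimensional subspaces of the left vector space $\mathcal{D}^{m+n}$, and $G(p,p+q;\mathcal{D}')$ the set of $p$-dimensional subspaces of $\mathcal{D}'^{\,p+q}$. For $W_1,W_2\in G(m,m+n;\mathcal{D})$ put $d(W_1,W_2)=m-\dim(W_1\cap W_2)$, and for $W_1,W_2\in G(p,p+q;\mathcal{D}')$ put $d(W_1,W_2)=p-\dim(W_1\cap W_2)$. If $\varphi:G(m,m+n;\mathcal{D})\to G(p,p+q;\mathcal{D}')$ is a surjection such that for all $A,B\in G(m,m+n;\mathcal{D})$, $$d(A,B)=\min\{m,n\}\iff d(A^{\varphi},B^{\varphi})=\min\{p,q\},$$ then $\varphi$ is bijective, both $\varphi$ and $\varphi^{-1}$ preserve adjacency of subspaces (two subspaces being adjacent iff $d=1$, i.e. their intersection has codimension $1$ in each), and $\min\{m,n\}=\min\{p,q\}$.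
   Context: $A^{\varphi}$ denotes the image of $A$ under $\varphi$. The function $d$ equals graph distance in the graph on the Grassmann space with adjacency defined by $d=1$. *)

(* Defs.v *)
From HB Require Import structures.
From mathcomp Require Import all_boot all_order all_algebra.
From mathcomp Require Import boolp classical_sets.

Set Implicit Arguments.
Unset Strict Implicit.
Unset Printing Implicit Defensive.

Import GRing.Theory.

Local Open Scope classical_set_scope.
Local Open Scope ring_scope.

(* A unitRingType is nontrivial by construction, so no condition 1 != 0 is
   needed. *)
Definition division_ring (D : unitRingType) : Prop :=
  forall x : D, x != 0 -> x \is a GRing.unit.

Definition subspace (D : nzRingType) (V : lmodType D) (W : set V) : Prop :=
  submod_closed [in W].

Definition basis (D : nzRingType) (V : lmodType D) (k : nat)
    (W : set V) (b : 'I_k -> V) : Prop :=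
  (forall c : 'I_k -> D, \sum_i c i *: b i = 0 -> forall i, c i = 0) /\
  W = [set v | exists c : 'I_k -> D, v = \sum_i c i *: b i].

(* The size of a basis of W; the value 0 is also taken when W has no finite
   basis, which does not occur for subspaces of 'rV[D]_N over a division ring
   D. *)
Definition subspace_dim (D : nzRingType) (V : lmodType D) (W : set V) : nat :=
  xget 0%N [set k | exists b : 'I_k -> V, basis W b].

(* The scaling of 'rV[D]_N is a *: v = (a * v_j)_j, so that 'rV[D]_N is the
   left vector space D^N. *)
Definition grassmann (D : nzRingType) (k N : nat) : Type :=
  {W : set 'rV[D]_N | subspace W /\ subspace_dim W = k}.

(* The subtraction on nat does not truncate: the intersection has dimension at
   most k. *)
Definition grassmann_dist (D : nzRingType) (k N : nat)
    (W1 W2 : grassmann D k N) : nat :=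
  (k - subspace_dim (sval W1 `&` sval W2))%N.

Definition adjacent (D : nzRingType) (k N : nat)
    (W1 W2 : grassmann D k N) : Prop :=
  grassmann_dist W1 W2 = 1%N.

(* Main.v *)
Require Import Defs.
From HB Require Import structures.
From mathcomp Require Import all_boot all_order all_algebra.
From mathcomp Require Import boolp classical_sets.
From mathcomp Require Import zify.

(* The adjacency of the Grassmann graph is recovered from the relation "at
   maximal distance", called opposition: distinct A and B are adjacent iff some
   P other than A and B has each of its opposites opposite to A or to B.  If A
   and B are adjacent, any third P in the pencil they span will do.  If they
   are not, then for every P two points of A and B outside P span a line
   disjoint from P, which extends to an opposite of P meeting both A and B.
   Distinct subspaces have distinct sets of opposites, so phi is injective; as
   d is the graph distance of adjacency, the diameters agree.

   This takes m <= n, where opposite means disjoint.  The case n <= m is the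
   same argument in the dual lattice, so it is carried out for lattices
   satisfying a self-dual list of axioms. *)

Set Implicit Arguments.
Unset Strict Implicit.
Unset Printing Implicit Defensive.

Import GRing.Theory.

(** * Graphs whose adjacency is determined by opposition *)

(** Opposition is the relation [d X Y = delta]. The fields [dist_pred] and [dist_adjacent] are the
    two inequalities that tie [d] to the path distance of the relation [d = 1]. *)
Record opposition_graph (T : Type) (d : T -> T -> nat) (delta : nat) : Prop :=
  OppositionGraph {
    adjacencyP : forall A B, d A B = 1 <->
      A <> B /\ exists P, [/\ P <> A, P <> B &
        forall X, d X P = delta -> d X A = delta \/ d X B = delta];
    opposite_separated : forall A B, A <> B ->
      exists X, d X A = delta /\ d X B <> delta;
    opposite_exists : exists A B, d A B = delta;
    dist_pred : forall A B j, d A B = j.+1 ->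
      exists C, d A C <= j /\ d C B = 1;
    dist_adjacent : forall A B C, d C B = 1 -> d A B <= (d A C).+1;
    dist_eq0 : forall A B, d A B = 0 -> A = B;
    dist_refl : forall A, d A A = 0 }.

(** The criterion [adjacencyP] speaks only of equality and opposition, so a bijection respecting
    both carries the witness [P] to [phi P]; the inverse is used to write an arbitrary [X] as an
    image. *)
Lemma opposition_adjacent (T T' : Type) (d : T -> T -> nat)
    (d' : T' -> T' -> nat) (delta delta' : nat)
    (phi : T -> T') (psi : T' -> T) :
  opposition_graph d delta -> opposition_graph d' delta' ->
  cancel phi psi -> cancel psi phi ->
  (forall A B, d A B = delta <-> d' (phi A) (phi B) = delta') ->
  forall A B, d A B = 1 -> d' (phi A) (phi B) = 1.
Proof.
move=> G G' phiK psiK opp A B /(adjacencyP G)[AB [P [PA PB PX]]].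
apply/(adjacencyP G'); split; first by move/(can_inj phiK).
exists (phi P); split; [by move/(can_inj phiK)|by move/(can_inj phiK)|].
move=> X; rewrite -(psiK X) => /opp/PX[] /opp; [by left|by right].
Qed.

(** A shortest path is sent to a path, step by step. *)
Lemma dist_nonincreasing (T T' : Type) (d : T -> T -> nat)
    (d' : T' -> T' -> nat) (delta delta' : nat) (phi : T -> T') :
  opposition_graph d delta -> opposition_graph d' delta' ->
  (forall A B, d A B = 1 -> d' (phi A) (phi B) = 1) ->
  forall A B, d' (phi A) (phi B) <= d A B.
Proof.
(* The induction runs on an upper bound of [d A B], since [dist_pred] only bounds the distance to
   the intermediate point. *)
move=> G G' adj A B; move: {2}(d A B) (leqnn (d A B)) => j.
elim: j A B => [|j IHj] A B dj.
  have d0 : d A B = 0 by lia.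
  by rewrite (dist_eq0 G d0) (dist_refl G').
case E : (d A B) => [|i].
  by rewrite (dist_eq0 G E) (dist_refl G').
have [C [AC CB]] := dist_pred G E.
have := dist_adjacent G' (phi A) (adj _ _ CB).
have : d' (phi A) (phi C) <= d A C by apply: IHj; lia.
lia.
Qed.

(** * Self-dual lattice axioms *)

(** Bottom and top are not part of the data: [pg_nonempty] and [pg_compl] provide elements of
    dimension [0] and [N]. The field [pg_third] says that every line has a third point, stated for
    an arbitrary interval of length 2. *)
Record projective_geometry (L : Type) (le : L -> L -> Prop)
    (meet join : L -> L -> L) (dim : L -> nat) (N : nat) : Prop :=
  ProjectiveGeometry {
    pg_le_trans : forall b a c, le a b -> le b c -> le a c;
    pg_le_refl : forall a, le a a;
    pg_meetP : forall a b c, le c (meet a b) <-> le c a /\ le c b;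
    pg_joinP : forall a b c, le (join a b) c <-> le a c /\ le b c;
    pg_dim_le : forall a b, le a b -> dim a <= dim b;
    pg_dim_eq : forall a b, le a b -> dim a = dim b -> a = b;
    pg_dim_mod : forall a b, dim (meet a b) + dim (join a b) = dim a + dim b;
    pg_dim_bound : forall a, dim a <= N;
    pg_nonempty : exists _ : L, True;
    pg_between : forall a b k, le a b -> dim a <= k <= dim b ->
      exists c, [/\ le a c, le c b & dim c = k];
    pg_compl : forall a, exists c, dim (meet a c) = 0 /\ dim (join a c) = N;
    pg_third : forall a b, dim a = dim b -> (dim (meet a b)).+1 = dim a ->
      exists c, [/\ c <> a, c <> b, dim c = dim a,
                    le (meet a b) c & le c (join a b)] }.

(** The bound by [N] keeps the subtractions from truncating. By modularity, for two elements of
    equal dimension the meet lies one below them exactly when the join lies one above, so the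
    premise of [pg_third] is its own dual. *)
Lemma projective_geometry_dual (L : Type) (le : L -> L -> Prop)
    (meet join : L -> L -> L) (dim : L -> nat) (N : nat) :
  projective_geometry le meet join dim N ->
  projective_geometry (fun a b => le b a) join meet (fun a => N - dim a) N.
Proof.
move=> G; have bnd := pg_dim_bound G; have md := pg_dim_mod G.
split.
- by move=> b a c ba cb; apply: (pg_le_trans G) cb ba.
- exact: (pg_le_refl G).
- by move=> a b c; apply: (pg_joinP G).
- by move=> a b c; apply: (pg_meetP G).
- by move=> a b /(pg_dim_le G); lia.
- move=> a b /(pg_dim_eq G) ba Nab; apply/esym/ba.
  by have := bnd a; have := bnd b; lia.
- move=> a b; have := md a b; have := bnd (meet a b); have := bnd (join a b).
  by have := bnd a; have := bnd b; lia.
- by move=> a; lia.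
- exact: (pg_nonempty G).
- move=> a b k ba abk; have := bnd a; have := bnd b => Nb Na.
  have [|c [bc ca ck]] := pg_between G (k := N - k) ba; first by lia.
  by exists c; split=> //; lia.
- by move=> a; have [c [c0 cN]] := pg_compl G a; exists c; lia.
- move=> a b; have := bnd a; have := bnd b; have := bnd (join a b).
  have := md a b => ? ? ? ? ? ?.
  have [||c [ca cb cdim abc cab]] := pg_third G (a := a) (b := b); [lia|lia|].
  by exists c; split=> //; lia.
Qed.

(** * Disjointness and adjacency among elements of dimension [k] *)

Section Geometry.

Variables (L : Type) (le : L -> L -> Prop) (meet join : L -> L -> L).
Variables (dim : L -> nat) (N : nat).
Hypothesis G : projective_geometry le meet join dim N.

Let le_trans := pg_le_trans G.
Let le_refl := pg_le_refl G.
Let dim_mod := pg_dim_mod G.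
Let dim_le := pg_dim_le G.

Lemma pg_meetl a b : le (meet a b) a.
Proof. by have [] := (pg_meetP G a b (meet a b)).1 (le_refl _). Qed.

Lemma pg_meetr a b : le (meet a b) b.
Proof. by have [] := (pg_meetP G a b (meet a b)).1 (le_refl _). Qed.

Lemma pg_joinl a b : le a (join a b).
Proof. by have [] := (pg_joinP G a b (join a b)).1 (le_refl _). Qed.

Lemma pg_joinr a b : le b (join a b).
Proof. by have [] := (pg_joinP G a b (join a b)).1 (le_refl _). Qed.

Let meetl := pg_meetl.
Let meetr := pg_meetr.
Let joinl := pg_joinl.
Let joinr := pg_joinr.

Lemma pg_meet_glb a b c : le c a -> le c b -> le c (meet a b).
Proof. by move=> ca cb; apply/(pg_meetP G). Qed.

Lemma pg_join_lub a b c : le a c -> le b c -> le (join a b) c.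
Proof. by move=> ac bc; apply/(pg_joinP G). Qed.

Lemma pg_meet_dim_le a b c e : le c a -> le e b ->
  dim (meet c e) <= dim (meet a b).
Proof.
move=> ca eb; apply: dim_le; apply: pg_meet_glb.
  exact: le_trans (meetl _ _) ca.
exact: le_trans (meetr _ _) eb.
Qed.

Lemma pg_le_dim_meet a b : dim (meet a b) = dim a -> le a b.
Proof. by move=> e; rewrite -{1}(pg_dim_eq G (meetl a b) e); apply: meetr. Qed.

Lemma pg_dim0_le a b : dim a = 0 -> le a b.
Proof.
by move=> a0; apply: pg_le_dim_meet; have := dim_le (meetl a b); lia.
Qed.

(** A complement [c] of [meet a b] must meet [a], by dimension count; an atom of [meet a c] under
    [b] would lie in [meet (meet a b) c], of dimension 0. *)
Lemma pg_atom a b : ~ le a b -> exists x, [/\ dim x = 1, le x a & ~ le x b].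
Proof.
move=> ab; have [c [c0 cN]] := pg_compl G (meet a b).
have lt : dim (meet a b) < dim a.
  rewrite ltn_neqAle dim_le // andbT; apply/eqP => /pg_le_dim_meet; exact: ab.
have [|x [_ xac x1]] := pg_between G (k := 1) (pg_dim0_le (meet a c) c0).
  have := dim_mod (meet a b) c; have := dim_mod a c.
  by have := pg_dim_bound G (join a c); lia.
exists x; split=> //; first exact: le_trans xac (meetl _ _).
move=> xb; suff /dim_le : le x (meet (meet a b) c) by lia.
apply: pg_meet_glb; last exact: le_trans xac (meetr _ _).
by apply: pg_meet_glb => //; apply: le_trans xac (meetl _ _).
Qed.

(** If [c] is a complement of [join a p], then [join a c] is a complement of [p] above [a]; any
    element of dimension [k] between [a] and it will do. *)
Lemma pg_extend_disjoint a p k : dim (meet a p) = 0 ->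
  dim a <= k -> k + dim p <= N ->
  exists x, [/\ le a x, dim x = k & dim (meet x p) = 0].
Proof.
move=> ap0 ak kN; have [c [c0 cN]] := pg_compl G (join a p).
set y := join a c.
have yp : le (join (join a p) c) (join y p).
  apply: pg_join_lub; last exact: le_trans (joinr a c) (joinl _ _).
  apply: pg_join_lub; last exact: joinr.
  exact: le_trans (joinl a c) (joinl _ _).
have ac0 : dim (meet a c) = 0.
  by have := pg_meet_dim_le (joinl a p) (le_refl c); lia.
have dy : dim y + dim p = N.
  have := dim_mod a p; have := dim_mod (join a p) c; have := dim_mod a c.
  by rewrite -/y; lia.
have [|x [ax xy xk]] := pg_between G (k := k) (joinl a c).
  by rewrite -/y; lia.
exists x; split=> //.
have := pg_meet_dim_le xy (le_refl p); rewrite -/y.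
have := dim_mod y p; have := dim_le yp.
by have := pg_dim_bound G (join y p); lia.
Qed.

Lemma pg_exists_dim k : k <= N -> exists a, dim a = k.
Proof.
move=> kN; have [x _] := pg_nonempty G; have [c [c0 cN]] := pg_compl G x.
have [|a [_ _ ak]] := pg_between G (k := k) (pg_dim0_le (join x c) c0).
  by lia.
by exists a.
Qed.

Lemma pg_atom_disjoint a p : dim a = 1 -> ~ le a p -> dim (meet a p) = 0.
Proof.
move=> a1 ap; have := dim_le (meetl a p).
case E : (dim (meet a p)) => [|[|i]] //; last by lia.
by case: ap; apply: pg_le_dim_meet; lia.
Qed.

Lemma pg_neq_dim a b : dim a = dim b -> a <> b -> ~ le a b.
Proof. by move=> ab neq /(pg_dim_eq G) /(_ ab). Qed.

Variable k : nat.
Hypotheses (k_gt1 : 1 < k) (kN : k + k <= N).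

(** Since [c] has codimension 1 in [join a b], the part [y] of [x] in this join is at most an atom.
    If [x] met both [a] and [b], then [y] would lie under both, hence under [meet a b] and under
    [c]. *)
Lemma pg_third_opposite a b c x :
  dim a = k -> dim b = k -> dim (meet a b) = k.-1 ->
  dim c = k -> le (meet a b) c -> le c (join a b) ->
  dim (meet x c) = 0 -> dim (meet x a) = 0 \/ dim (meet x b) = 0.
Proof.
move=> ak bk abk ck abc cab xc0.
have dJ : dim (join a b) = k.+1 by have := dim_mod a b; lia.
set y := meet x (join a b).
have yc0 : dim (meet y c) = 0.
  by have := pg_meet_dim_le (meetl x (join a b)) (le_refl c); rewrite -/y; lia.
have yJ : le (join y c) (join a b) by apply: pg_join_lub => //; apply: meetr.
have y1 : dim y <= 1 by have := dim_mod y c; have := dim_le yJ; lia.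
have sub z : le z (join a b) -> dim (meet x z) <> 0 -> le y z.
  move=> zJ xz; have xzy : le (meet x z) y.
    by apply: pg_meet_glb; [exact: meetl|exact: le_trans (meetr _ _) zJ].
  rewrite -(pg_dim_eq G xzy); first exact: meetr.
  by have := dim_le xzy; lia.
case: (eqVneq (dim (meet x a)) 0) => [|/eqP xa]; first by left.
case: (eqVneq (dim (meet x b)) 0) => [|/eqP xb]; first by right.
have := sub a (joinl _ _) xa; have := sub b (joinr _ _) xb => yb ya.
have /dim_le : le y (meet x c).
  apply: pg_meet_glb; first exact: meetl.
  by apply: le_trans abc; apply: pg_meet_glb.
have : dim (meet x a) <= dim y.
  apply/dim_le/pg_meet_glb; first exact: meetl.
  exact: le_trans (meetr _ _) (joinl _ _).
by lia.
Qed.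

(* Atoms x under a and y under b outside p span a line disjoint from p, unless
   all such atoms generate the same p + x, which then contains a and b. *)
Lemma pg_nonadjacent_opposite a b p :
  dim a = k -> dim b = k -> dim p = k -> dim (meet a b) < k.-1 ->
  p <> a -> p <> b ->
  exists x, [/\ dim x = k, dim (meet x p) = 0,
                dim (meet x a) <> 0 & dim (meet x b) <> 0].
Proof.
move=> ak bk pk abk pa pb.
have [|x [x1 xa xp]] := @pg_atom a p.
  by apply: pg_neq_dim; [lia|move=> e; apply: pa].
have [y [y1 yb yp]] : exists y, [/\ dim y = 1, le y b & ~ le y p].
  by apply: pg_atom; apply: pg_neq_dim; [lia|move=> e; apply: pb].
have xp0 := pg_atom_disjoint x1 xp.
have yp0 := pg_atom_disjoint y1 yp.
have dxp : dim (join x p) = k.+1 by have := dim_mod x p; lia.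
have dyp : dim (join y p) = k.+1 by have := dim_mod y p; lia.
(* As [v] is outside [join u p], the line [join u v] misses [p]; it fits into dimension [k] because
   [1 < k], and extends because [k + k <= N]. *)
have main u v : dim u = 1 -> dim v = 1 -> le u a -> le v b -> ~ le u p ->
    ~ le v (join u p) ->
  exists x, [/\ dim x = k, dim (meet x p) = 0,
                dim (meet x a) <> 0 & dim (meet x b) <> 0].
  move=> u1 v1 ua vb up vup.
  have up0 := pg_atom_disjoint u1 up.
  have vup0 := pg_atom_disjoint v1 vup.
  have J : le (join v (join u p)) (join (join u v) p).
    apply: pg_join_lub; first exact: le_trans (joinr u v) (joinl _ _).
    apply: pg_join_lub; last exact: joinr.
    exact: le_trans (joinl u v) (joinl _ _).
  have [|||z [uvz zk zp]] := @pg_extend_disjoint (join u v) p k.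
  - have := dim_mod u v; have := dim_mod u p; have := dim_mod v (join u p).
    by have := dim_mod (join u v) p; have := dim_le J; lia.
  - by have := dim_mod u v; lia.
  - by lia.
  exists z; split=> //.
    have : dim u <= dim (meet z a); last by lia.
    by apply/dim_le/pg_meet_glb=> //; apply: le_trans (joinl u v) uvz.
  have : dim v <= dim (meet z b); last by lia.
  by apply/dim_le/pg_meet_glb=> //; apply: le_trans (joinr u v) uvz.
have [bxp|/pg_atom[v [v1 vb vxp]]] := pselect (le b (join x p)); last first.
  exact: main x1 v1 xa vb xp vxp.
have exy : join y p = join x p.
  apply: (pg_dim_eq G); last by lia.
  by apply: pg_join_lub; [exact: le_trans yb bxp|exact: joinr].
have [axp|/pg_atom[u [u1 ua uxp]]] := pselect (le a (join x p)); last first.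
  (* Exchange: if [y] were under [join u p], then [join u p] would equal [join y p], which is
     [join x p], and [u] would lie in it. *)
  apply: (main u y) => //.
    by move=> up; apply: uxp; apply: le_trans up (joinr _ _).
  move=> yup; apply: uxp.
  have yup' : le (join y p) (join u p).
    by apply: pg_join_lub => //; apply: joinr.
  rewrite -exy (pg_dim_eq G yup') ?joinl //.
  by have := dim_le yup'; have := dim_mod u p; lia.
(* With both [a] and [b] under an element of dimension [k.+1], their meet would have dimension at
   least [k.-1]. *)
have /dim_le : le (join a b) (join x p) by apply: pg_join_lub.
by have := dim_mod a b; lia.
Qed.

(** The embedding [f] identifies [T] with the elements of dimension [k], so that one type of
    subspaces can be read both in a lattice and in its dual. *)
Lemma pg_opposition_graph (T : Type) (f : T -> L) (d : T -> T -> nat) :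
  injective f -> (forall t, dim (f t) = k) ->
  (forall a, dim a = k -> exists t, f t = a) ->
  (forall s t, d s t = k - dim (meet (f s) (f t))) ->
  opposition_graph d k.
Proof.
move=> f_inj f_dim f_surj dE.
have dopp s t : d s t = k <-> dim (meet (f s) (f t)) = 0.
  by have := dim_le (meetl (f s) (f t)); rewrite dE f_dim; lia.
have d1 s t : d s t = 1 <-> dim (meet (f s) (f t)) = k.-1.
  by have := dim_le (meetl (f s) (f t)); rewrite dE f_dim; lia.
have fneq s t : s <> t -> f s <> f t by move=> st /f_inj.
have d0 s t : d s t = 0 -> s = t.
  rewrite dE => st; apply: f_inj; apply: (pg_dim_eq G); rewrite ?f_dim//.
  apply: pg_le_dim_meet; have := dim_le (meetl (f s) (f t)).
  by rewrite f_dim; lia.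
have dtt t : d t t = 0.
  have /dim_le : le (f t) (meet (f t) (f t)) by apply: pg_meet_glb.
  by rewrite dE f_dim; lia.
split=> //.
- move=> A B; split.
    move=> AB; split; first by move=> e; move: AB; rewrite e dtt.
    move/d1: AB => AB.
    have [||c [cA cB cdim ABc cAB]] := pg_third G (a := f A) (b := f B).
    + by rewrite !f_dim.
    + by rewrite AB f_dim; lia.
    rewrite f_dim in cdim; have [P fP] := f_surj _ cdim.
    exists P; split; [by move=> e; apply: cA; rewrite -fP e
                     |by move=> e; apply: cB; rewrite -fP e|].
    move=> X /dopp; rewrite fP !dopp => Xc.
    exact: (@pg_third_opposite (f A) (f B) c).
  move=> [AB [P [PA PB PX]]]; apply/d1/eqP; apply: contraT => /eqP AB1.
  have AB' : dim (meet (f A) (f B)) < k.-1.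
    have := dim_le (meetl (f A) (f B)); rewrite f_dim.
    suff : dim (meet (f A) (f B)) <> k by lia.
    rewrite -(f_dim A) => /pg_le_dim_meet/(pg_dim_eq G).
    by rewrite !f_dim => /(_ erefl)/f_inj.
  have [x [xk xP xA xB]] := pg_nonadjacent_opposite (f_dim A) (f_dim B)
    (f_dim P) AB' (fneq _ _ PA) (fneq _ _ PB).
  have [X fX] := f_surj _ xk; move/(_ X): PX; rewrite !dopp fX.
  by move/(_ xP) => -[].
(* An atom of [f B] outside [f A] extends to an opposite of [A], which still meets [f B]. *)
- move=> A B AB; have [|x [x1 xB xA]] := @pg_atom (f B) (f A).
    by apply: pg_neq_dim; [rewrite !f_dim|apply: fneq => e; apply: AB].
  have [||y [xy yk yA]] := pg_extend_disjoint (k := k)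
      (pg_atom_disjoint x1 xA).
  + by lia.
  + by rewrite f_dim.
  have [X fX] := f_surj _ yk; exists X; rewrite !dopp fX; split=> //.
  have /dim_le : le x (meet y (f B)) by apply: pg_meet_glb.
  by lia.
- have [|z z0] := @pg_exists_dim 0; first by lia.
  have [|a ak] := @pg_exists_dim k; first by lia.
  have [|||y [_ yk ya]] := @pg_extend_disjoint z a k.
  + by have := dim_le (meetl z a); lia.
  + by lia.
  + by lia.
  have [A fA] := f_surj _ ak; have [B fB] := f_surj _ yk.
  by exists B, A; apply/dopp; rewrite fA fB.
(* The next-to-last point of a path is [join e g], where [e] in [f A] is one dimension above the
   intersection and [g] is a hyperplane of [f B] containing it. Since [e] and [g] meet exactly in
   the intersection, the join has dimension [k]. *)
- move=> A B j ABj; have := ABj; rewrite dE => dj.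
  have := dim_le (meetl (f A) (f B)); rewrite f_dim => ABk.
  have [|e [ABe eA de]] := pg_between G (k := (dim (meet (f A) (f B))).+1)
      (meetl (f A) (f B)).
    by rewrite f_dim; lia.
  have [|g [ABg gB dg]] := pg_between G (k := k.-1) (meetr (f A) (f B)).
    by rewrite f_dim; lia.
  have deg : dim (meet e g) = dim (meet (f A) (f B)).
    apply/anti_leq/andP; split; first exact: pg_meet_dim_le.
    by apply/dim_le/pg_meet_glb.
  have [|C fC] := f_surj (join e g).
    by have := dim_mod e g; lia.
  exists C; split.
    have /dim_le : le e (meet (f A) (f C)).
      by apply: pg_meet_glb => //; rewrite fC.
    by rewrite dE; lia.
  apply/d1.
  have /dim_le : le g (meet (f C) (f B)).
    by apply: pg_meet_glb => //; rewrite fC.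
  have := dim_le (meetl (f C) (f B)); rewrite f_dim.
  suff : dim (meet (f C) (f B)) <> k by lia.
  rewrite -(f_dim C) => /pg_le_dim_meet CB.
  have /dim_le : le e (meet (f A) (f B)); last by lia.
  by apply: pg_meet_glb => //; apply: le_trans CB; rewrite fC.
(* Modularity inside [f C]: a hyperplane of [f C] cuts the dimension of [meet (f A) (f C)] by at
   most one. *)
- move=> A B C /d1 CB; rewrite !dE.
  have := dim_mod (meet (f A) (f C)) (meet (f C) (f B)).
  have : dim (join (meet (f A) (f C)) (meet (f C) (f B))) <= dim (f C).
    by apply/dim_le/pg_join_lub; [exact: meetr|exact: meetl].
  rewrite f_dim.
  have := pg_meet_dim_le (meetl (f A) (f C)) (meetr (f C) (f B)).
  by have := dim_le (meetl (f A) (f C)); rewrite f_dim; lia.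
Qed.

End Geometry.

(** * Linear algebra over a division ring and the lattice of subspaces *)

Section Subspaces.

Local Open Scope ring_scope.
Local Open Scope classical_set_scope.

Variable D : unitRingType.
Hypothesis divD : division_ring D.

(** Gaussian elimination of the first column, with all coefficients acting on the left. *)
Lemma exists_row_dependency (l k : nat) (c : 'I_k -> 'I_l -> D) : (l < k)%N ->
  exists x : 'I_k -> D,
    (exists i, x i != 0) /\ forall j, \sum_i x i * c i j = 0.
Proof.
elim: l k c => [|l IHl] [|k] c // lk.
  by exists (fun=> 1); split=> [|[]//]; exists ord0; apply: oner_neq0.
have [[i0 ci0]|c0] := pselect (exists i, c i ord0 != 0); last first.
  have [x [x0 xc]] := IHl k.+1 (fun i j => c i (lift ord0 j)) (ltnW lk).
  exists x; split=> // j; case: (unliftP ord0 j) => [j' ->|->]; first exact: xc.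
  apply: big1 => i _; suff /eqP-> : c i ord0 == 0 by rewrite mulr0.
  by apply: contra_notT c0 => ci; exists i.
have ciU := divD ci0.
(* The inverse of the pivot stands on the right, so that row [i] minus [r i] times the pivot row
   vanishes in column [ord0]. *)
set r := fun i => c (lift i0 i) ord0 * (c i0 ord0)^-1.
have [y [[i yi] yc]] := IHl k
  (fun i j => c (lift i0 i) (lift ord0 j) - r i * c i0 (lift ord0 j)) lk.
exists (fun i => oapp y (- \sum_i y i * r i) (unlift i0 i)); split.
  by exists (lift i0 i); rewrite liftK.
move=> j; rewrite (bigD1_ord i0) //= unlift_none /=.
rewrite [X in _ + X](eq_bigr (fun i => y i * c (lift i0 i) j)); last first.
  by move=> i' _; rewrite liftK.
case: (unliftP ord0 j) => [j' ->|->]; last first.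
  rewrite mulNr mulr_suml -sumrN -big_split big1//= => i' _.
  by rewrite -!mulrA /r mulVr // mulr1 addNr.
rewrite mulNr mulr_suml -sumrN -big_split -[RHS](yc j') /=.
by apply: eq_bigr => i' _; rewrite addrC mulrBr -mulrA.
Qed.

Variable N : nat.
Local Notation V := 'rV[D]_N.
Local Notation subsp := {W : set V | subspace W}.

Implicit Types (W A B C : subsp) (u v w : V) (a : D).

Lemma subspP (W : set V) : subspace W <->
  W 0 /\ forall a u v, W u -> W v -> W (a *: u + v).
Proof.
split=> [[W0 WD]|[W0 WD]].
  split=> [|a u v Wu Wv]; first by have := W0; rewrite in_setE.
  by have := WD a u v; rewrite !in_setE; apply.
by split=> [|a u v]; rewrite !in_setE //; apply: WD.
Qed.

Lemma subsp0 W : sval W 0.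
Proof. by case: W => W /= /subspP[]. Qed.

Lemma subsp_lin W a u v : sval W u -> sval W v -> sval W (a *: u + v).
Proof. by case: W => W /= /subspP[_]; apply. Qed.

Lemma subspZ W a u : sval W u -> sval W (a *: u).
Proof.
by move=> Wu; rewrite -[_ *: _]addr0; apply: subsp_lin => //; apply: subsp0.
Qed.

Lemma subspD W u v : sval W u -> sval W v -> sval W (u + v).
Proof. by move=> Wu Wv; rewrite -[u]scale1r; apply: subsp_lin. Qed.

Lemma subspB W u v : sval W u -> sval W v -> sval W (u - v).
Proof. by move=> Wu Wv; rewrite addrC -scaleN1r; apply: subsp_lin. Qed.

Lemma subsp_eq A B : sval A `<=` sval B -> sval B `<=` sval A -> A = B.
Proof.
move=> AB BA; apply: eq_sig_hprop; first by move=> *; apply: Prop_irrelevance.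
exact/seteqP.
Qed.

Lemma subsp_meet_subproof A B : subspace (sval A `&` sval B).
Proof.
apply/subspP; split=> [|a u v [Au Bu] [Av Bv]]; split;
  by [apply: subsp0|apply: subsp_lin].
Qed.
Definition subsp_meet A B : subsp := exist _ _ (subsp_meet_subproof A B).

Lemma subsp_join_subproof A B :
  subspace [set v | exists2 u, sval A u & sval B (v - u)].
Proof.
apply/subspP; split=> [|a u v [u' Au Bu] [v' Av Bv]] /=.
  by exists 0; rewrite ?subrr; apply: subsp0.
exists (a *: u' + v'); first exact: subsp_lin.
by rewrite opprD addrACA -scalerBr; apply: subsp_lin.
Qed.
Definition subsp_join A B : subsp := exist _ _ (subsp_join_subproof A B).

Lemma subsp_line_subproof v : subspace [set u | exists a, u = a *: v].
Proof.
apply/subspP; split=> [|a u w [x ->] [y ->]].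
  by exists 0; rewrite scale0r.
by exists (a * x + y); rewrite scalerDl scalerA.
Qed.
Definition subsp_line v : subsp := exist _ _ (subsp_line_subproof v).

Definition subsp_full : subsp :=
  exist _ setT ((subspP setT).2 (conj I (fun _ _ _ _ _ => I))).

Lemma subsp_zero_subproof : subspace [set (0 : V)].
Proof.
by apply/subspP; split=> // a u v -> ->; rewrite scaler0 addr0.
Qed.
Definition subsp_zero : subsp := exist _ _ subsp_zero_subproof.

Lemma subsp_joinl A B : sval A `<=` sval (subsp_join A B).
Proof. by move=> v Av; exists v; rewrite // subrr; apply: subsp0. Qed.

Lemma subsp_joinr A B : sval B `<=` sval (subsp_join A B).
Proof. by move=> v Bv; exists 0; rewrite ?subr0 //; apply: subsp0. Qed.

Lemma subsp_join_lub A B C :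
  sval A `<=` sval C -> sval B `<=` sval C -> sval (subsp_join A B) `<=` sval C.
Proof.
move=> AC BC v [u Au Bvu]; rewrite -[v](subrK u).
by apply: subspD; [apply: BC|apply: AC].
Qed.

Lemma subsp_line_mem v : sval (subsp_line v) v.
Proof. by exists 1; rewrite scale1r. Qed.

Lemma subsp_line_sub v W : sval W v -> sval (subsp_line v) `<=` sval W.
Proof. by move=> Wv u [a ->]; apply: subspZ. Qed.

Lemma basis_mem (W : set V) k (b : 'I_k -> V) i : basis W b -> W (b i).
Proof.
move=> [_ ->]; exists (fun j => (j == i)%:R).
rewrite (bigD1 i) //= eqxx scale1r big1 ?addr0 // => j /negPf->.
by rewrite scale0r.
Qed.

(** With more [b] than [b'], the coordinate rows of [b] would be dependent, and so would [b].
    Equality of the two spaces then gives invariance of dimension. *)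
Lemma basis_size_le (W W' : set V) k l (b : 'I_k -> V) (b' : 'I_l -> V) :
  basis W b -> basis W' b' -> W `<=` W' -> (k <= l)%N.
Proof.
move=> bW bW' WW'; rewrite leqNgt; apply/negP => lk.
have bc i : exists c : 'I_l -> D, b i = \sum_j c j *: b' j.
  by have := WW' _ (basis_mem i bW); rewrite {1}bW'.2.
have [c bE] := choice bc.
have [x [[i xi] xc]] := exists_row_dependency c lk.
move/eqP: xi; apply; apply: bW.1.
under eq_bigr do rewrite bE scaler_sumr.
rewrite exchange_big big1 // => j _.
under eq_bigr do rewrite scalerA.
by rewrite -scaler_suml xc scale0r.
Qed.

Lemma basis_adjoin W v k (b : 'I_k -> V) : ~ sval W v -> basis (sval W) b ->
  basis (sval (subsp_join (subsp_line v) W))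
    (fun i : 'I_k.+1 => oapp b v (unlift ord0 i)).
Proof.
move=> Wv [bfree bW].
have sumE (c : 'I_k.+1 -> D) :
    \sum_i c i *: oapp b v (unlift ord0 i) =
    c ord0 *: v + \sum_i c (lift ord0 i) *: b i.
  rewrite big_ord_recl unlift_none /=; congr (_ + _).
  by apply: eq_bigr => i _; rewrite liftK.
have sumW (c : 'I_k -> D) : sval W (\sum_i c i *: b i).
  by rewrite bW; exists c.
split=> [c|].
  rewrite sumE => c0; have c00 : c ord0 = 0.
    (* A nonzero coefficient of [v] could be inverted, which would put [v] in [W]. *)
    apply: contra_notP Wv => /eqP/divD c0U; rewrite -[v]scale1r -(mulVr c0U).
    rewrite -scalerA; apply: subspZ.
    rewrite -[_ *: v](addrK (\sum_i c (lift ord0 i) *: b i)) c0.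
    by apply: subspB => //; apply: subsp0.
  move=> i; case: (unliftP ord0 i) => [j ->|->//].
  by move: c0; rewrite c00 scale0r add0r => /bfree.
apply/seteqP; split=> u /=.
  move=> [_ [a ->]]; rewrite {1}bW => -[c uE].
  exists (fun i => oapp c a (unlift ord0 i)); rewrite sumE unlift_none /=.
  under eq_bigr do rewrite liftK /=.
  by rewrite -uE addrC subrK.
move=> [c ->]; rewrite sumE; exists (c ord0 *: v); first by exists (c ord0).
by rewrite addrC addKr.
Qed.

Lemma basis_zero : basis [set (0 : V)] (fun i : 'I_0 => 0).
Proof.
split=> [c _ []//|]; apply/seteqP; split=> v /=.
  by move=> ->; exists (fun=> 0); rewrite big_ord0.
by move=> [c ->]; rewrite big_ord0.
Qed.

Lemma basis_full : basis [set: V] (fun i : 'I_N => 'e_i).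
Proof.
have sumE (c : 'I_N -> D) : \sum_i c i *: 'e_i = \row_i c i.
  by rewrite [RHS]row_sum_delta; apply: eq_bigr => i _; rewrite mxE.
split=> [c|].
  by rewrite sumE => /rowP c0 i; have := c0 i; rewrite !mxE.
apply/seteqP; split=> // v _; exists (v 0).
by rewrite sumE; apply/rowP => i; rewrite mxE.
Qed.

Lemma exists_basis W : exists k (b : 'I_k -> V), basis (sval W) b.
Proof.
(* Independent families in [W] are enlarged one vector at a time; size [N.+1] is excluded by the
   standard basis. *)
have step j : (exists k (b : 'I_k -> V), basis (sval W) b) \/
    exists U : subsp,
      sval U `<=` sval W /\ exists b : 'I_j -> V, basis (sval U) b.
  elim: j => [|j [|[U [UW [b Ub]]]]]; [right|by left|].
    exists subsp_zero; split=> [v ->|]; first exact: subsp0.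
    by exists (fun=> 0); apply: basis_zero.
  have [WU|/existsNP[v /not_implyP[Wv Uv]]] := pselect (sval W `<=` sval U).
    by left; exists j, b; rewrite (subsp_eq WU UW).
  right; exists (subsp_join (subsp_line v) U); split.
    by apply: subsp_join_lub => //; apply: subsp_line_sub.
  by eexists; apply: basis_adjoin Uv Ub.
case: (step N.+1) => // -[U [_ [b Ub]]].
by have := basis_size_le Ub basis_full (@subsetT _ _); rewrite ltnn.
Qed.

Definition subsp_dim W : nat := subspace_dim (sval W).

(** A basis exists, so the default 0 of [xget] never stands for a missing one. *)
Lemma subsp_dim_basis W : exists b : 'I_(subsp_dim W) -> V, basis (sval W) b.
Proof. exact: xgetPex (exists_basis W). Qed.

Lemma subsp_dimE W k (b : 'I_k -> V) : basis (sval W) b -> subsp_dim W = k.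
Proof.
move=> Wb; have [b' Wb'] := subsp_dim_basis W.
apply/anti_leq/andP.
by split; [apply: basis_size_le Wb' Wb _|apply: basis_size_le Wb Wb' _].
Qed.

Lemma subsp_dim_le A B : sval A `<=` sval B -> (subsp_dim A <= subsp_dim B)%N.
Proof.
have [a Aa] := subsp_dim_basis A; have [b Bb] := subsp_dim_basis B.
exact: basis_size_le Aa Bb.
Qed.

Lemma subsp_dim_adjoin W v : ~ sval W v ->
  subsp_dim (subsp_join (subsp_line v) W) = (subsp_dim W).+1.
Proof.
have [b Wb] := subsp_dim_basis W => Wv.
exact: subsp_dimE (basis_adjoin Wv Wb).
Qed.

Lemma subsp_dim_bound W : (subsp_dim W <= N)%N.
Proof.
by have [b Wb] := subsp_dim_basis W; apply: basis_size_le Wb basis_full _.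
Qed.

Lemma subsp_adjoin_sub W A v : sval A v -> sval W `<=` sval A ->
  sval (subsp_join (subsp_line v) W) `<=` sval A.
Proof. by move=> Av; apply/subsp_join_lub/subsp_line_sub. Qed.

(** Climbing from [A] to [B] by adjoining vectors of [B] stops, because each step raises a dimension
    bounded by [N]. *)
Lemma subsp_adjoin_ind (Q : subsp -> Prop) A B : sval A `<=` sval B -> Q A ->
  (forall C v, sval A `<=` sval C -> sval C `<=` sval B -> sval B v ->
     ~ sval C v -> Q C -> Q (subsp_join (subsp_line v) C)) -> Q B.
Proof.
move=> AB QA Qstep.
have step j : Q B \/ exists C, [/\ sval A `<=` sval C, sval C `<=` sval B,
    (j <= subsp_dim C)%N & Q C].
  elim: j => [|j [|[C [AC CB jC QC]]]]; [right|by left|].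
    by exists A; split=> //; exact: subset_refl.
  have [BC|/existsNP[v /not_implyP[Bv Cv]]] := pselect (sval B `<=` sval C).
    by left; rewrite (subsp_eq BC CB).
  right; exists (subsp_join (subsp_line v) C); split.
  - exact: subset_trans AC (@subsp_joinr _ _).
  - exact: subsp_adjoin_sub.
  - by rewrite subsp_dim_adjoin.
  - exact: Qstep.
by case: (step N.+1) => // -[C [_ _]]; rewrite leqNgt ltnS subsp_dim_bound.
Qed.

Lemma subsp_dim_eq A B :
  sval A `<=` sval B -> subsp_dim A = subsp_dim B -> A = B.
Proof.
move=> AB dAB; apply: subsp_eq => // v Bv; apply: contrapT => Av.
have := subsp_dim_le (subsp_adjoin_sub Bv AB).
by rewrite subsp_dim_adjoin // dAB ltnn.
Qed.

Lemma subsp_dim_mod A B : (subsp_dim (subsp_meet A B) +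
  subsp_dim (subsp_join A B) = subsp_dim A + subsp_dim B)%N.
Proof.
(* The subspace [C] climbs from the intersection to [A], and each new vector raises both sides by
   one. *)
pose Q C := (subsp_dim (subsp_meet A B) + subsp_dim (subsp_join C B) =
  subsp_dim C + subsp_dim B)%N.
apply: (@subsp_adjoin_ind Q (subsp_meet A B)); rewrite /Q.
- by move=> v [].
- rewrite (_ : subsp_join _ _ = B) //; apply: subsp_eq; last exact: subsp_joinr.
  by apply: subsp_join_lub => // v [].
move=> C v ABC CA Av Cv dC; rewrite subsp_dim_adjoin //.
have -> : subsp_join (subsp_join (subsp_line v) C) B =
    subsp_join (subsp_line v) (subsp_join C B).
  apply: subsp_eq.
    apply: subsp_join_lub.
      apply: subsp_join_lub; first exact: subsp_joinl.
      exact: subset_trans (@subsp_joinl C B) (@subsp_joinr _ _).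
    exact: subset_trans (@subsp_joinr C B) (@subsp_joinr _ _).
  apply: subsp_join_lub.
    exact: subset_trans (@subsp_joinl _ C) (@subsp_joinl _ _).
  apply: subsp_join_lub; last exact: subsp_joinr.
  exact: subset_trans (@subsp_joinr _ C) (@subsp_joinl _ _).
rewrite subsp_dim_adjoin; first by rewrite addnS dC.
(* If [v] is [u] plus a vector of [B], that vector also lies in [A], hence in [C]. *)
move=> [u Cu Bvu]; apply: Cv; rewrite -[v](subrK u); apply: subspD => //.
by apply: ABC; split=> //; apply: subspB => //; apply: CA.
Qed.

Lemma subsp_between A B k : sval A `<=` sval B ->
  (subsp_dim A <= k <= subsp_dim B)%N ->
  exists C, [/\ sval A `<=` sval C, sval C `<=` sval B & subsp_dim C = k].
Proof.
move=> AB /andP[Ak]; pose Q B := (k <= subsp_dim B)%N ->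
  exists C, [/\ sval A `<=` sval C, sval C `<=` sval B & subsp_dim C = k].
apply: (@subsp_adjoin_ind Q A B) => //.
  by move=> kA; exists A; split=> //; apply/anti_leq/andP.
move=> C v AC CB Bv Cv QC; rewrite /Q subsp_dim_adjoin // leq_eqVlt.
move=> /predU1P[->|].
  exists (subsp_join (subsp_line v) C).
  split=> //; last exact: subsp_dim_adjoin.
  exact: subset_trans AC (@subsp_joinr _ _).
rewrite ltnS => /QC[E [AE EC Ek]]; exists E; split=> //.
exact: subset_trans EC (@subsp_joinr _ _).
Qed.

Lemma subsp_dim_full : subsp_dim subsp_full = N.
Proof. exact: (@subsp_dimE subsp_full _ _ basis_full). Qed.

Lemma subsp_dim_zero : subsp_dim subsp_zero = 0%N.
Proof. exact: (@subsp_dimE subsp_zero _ _ basis_zero). Qed.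

Lemma subsp_compl A : exists C,
  subsp_dim (subsp_meet A C) = 0%N /\ subsp_dim (subsp_join A C) = N.
Proof.
suff [C [AC0 ACN]] : exists C, subsp_dim (subsp_meet A C) = 0%N /\
    subsp_join A C = subsp_full
  by exists C; rewrite ACN subsp_dim_full.
(* A complement of [A] within [B] is enlarged by the same vectors as [B], until [B] is the full
   space. *)
pose Q B := exists C, subsp_dim (subsp_meet A C) = 0%N /\ subsp_join A C = B.
apply: (@subsp_adjoin_ind Q A) => //.
  exists subsp_zero; split.
    apply/eqP; rewrite -leqn0 -subsp_dim_zero; apply: subsp_dim_le.
    by move=> v [].
  apply: subsp_eq; last exact: subsp_joinl.
  by apply: subsp_join_lub => // v ->; apply: subsp0.
move=> E v _ _ _ + [C [AC0 EC]]; rewrite -{}EC => ACv {E}.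
have Cv : ~ sval C v by move/(@subsp_joinr A).
have E : subsp_join A (subsp_join (subsp_line v) C) =
    subsp_join (subsp_line v) (subsp_join A C).
  apply: subsp_eq; apply: subsp_join_lub.
  - exact: subset_trans (@subsp_joinl A C) (@subsp_joinr _ _).
  - apply: subsp_join_lub; first exact: subsp_joinl.
    exact: subset_trans (@subsp_joinr A C) (@subsp_joinr _ _).
  - exact: subset_trans (@subsp_joinl _ C) (@subsp_joinr _ _).
  - apply: subsp_join_lub; first exact: subsp_joinl.
    exact: subset_trans (@subsp_joinr _ C) (@subsp_joinr _ _).
exists (subsp_join (subsp_line v) C); split=> //.
have := subsp_dim_mod A (subsp_join (subsp_line v) C).
rewrite E !subsp_dim_adjoin //; have := subsp_dim_mod A C; lia.
Qed.

(** For [u] in [A] only and [v] in [B] only, [u + v] lies in neither; this gives a third point over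
    every division ring, even with two elements. *)
Lemma subsp_third A B : subsp_dim A = subsp_dim B ->
  (subsp_dim (subsp_meet A B)).+1 = subsp_dim A ->
  exists C, [/\ C <> A, C <> B, subsp_dim C = subsp_dim A,
    sval (subsp_meet A B) `<=` sval C & sval C `<=` sval (subsp_join A B)].
Proof.
move=> dAB dM.
have [u [Au Bu]] : exists u, sval A u /\ ~ sval B u.
  apply: contrapT => nu; suff /subsp_dim_le : sval A `<=` sval (subsp_meet A B).
    by rewrite -dM ltnn.
  by move=> u Au; split=> //; apply: contrapT => Bu; apply: nu; exists u.
have [v [Bv Av]] : exists v, sval B v /\ ~ sval A v.
  apply: contrapT => nv; suff /subsp_dim_le : sval B `<=` sval (subsp_meet A B).
    by rewrite -dAB -dM ltnn.
  by move=> v Bv; split=> //; apply: contrapT => Av; apply: nv; exists v.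
have Auv : ~ sval A (u + v).
  by move=> Auv; apply: Av; rewrite -(addKr u v) addrC; apply: subspB.
have Buv : ~ sval B (u + v).
  by move=> Buv; apply: Bu; rewrite -(addrK v u); apply: subspB.
exists (subsp_join (subsp_line (u + v)) (subsp_meet A B)); split.
- by move=> e; apply: Auv; rewrite -e; apply/subsp_joinl/subsp_line_mem.
- by move=> e; apply: Buv; rewrite -{}e; apply/subsp_joinl/subsp_line_mem.
- by rewrite subsp_dim_adjoin // => -[].
- exact: subsp_joinr.
- apply: subsp_adjoin_sub; last by move=> w [/subsp_joinl].
  by apply: subspD; [apply: subsp_joinl|apply: subsp_joinr].
Qed.

Lemma subsp_projective_geometry :
  projective_geometry (fun A B => sval A `<=` sval B)
    subsp_meet subsp_join subsp_dim N.
Proof.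
split.
- by move=> B A C; apply: subset_trans.
- by move=> A; apply: subset_refl.
- by move=> A B C /=; rewrite subsetI.
- move=> A B C; split=> [ABC|[]]; last exact: subsp_join_lub.
  by split; apply: subset_trans ABC; [apply: subsp_joinl|apply: subsp_joinr].
- exact: subsp_dim_le.
- exact: subsp_dim_eq.
- exact: subsp_dim_mod.
- exact: subsp_dim_bound.
- by exists subsp_zero.
- exact: subsp_between.
- exact: subsp_compl.
- exact: subsp_third.
Qed.

End Subspaces.

(** * Grassmann spaces and the recovery of adjacency *)

Lemma grassmann_opposition_graph (D : unitRingType) (m n : nat) :
  division_ring D -> 2 <= m -> 2 <= n ->
  opposition_graph (@grassmann_dist D m (m + n)) (minn m n).
Proof.
move=> divD m2 n2; have G := subsp_projective_geometry divD (m + n).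
pose f (W : grassmann D m (m + n)) : {W : set 'rV[D]_(m + n) | subspace W} :=
  exist _ (sval W) (proj1 (proj2_sig W)).
have f_inj : injective f.
  move=> W1 W2 /(f_equal sval) /= eqW.
  by apply: eq_sig_hprop => // *; apply: Prop_irrelevance.
have f_dim W : subsp_dim (f W) = m by case: (proj2_sig W).
have f_surj A : subsp_dim A = m -> exists W, f W = A.
  move=> dA; exists (exist _ (sval A) (conj (proj2_sig A) dA)).
  by apply: eq_sig_hprop => // *; apply: Prop_irrelevance.
have dE W1 W2 : grassmann_dist W1 W2 =
  m - subsp_dim (subsp_meet (f W1) (f W2)) by [].
have [mn|nm] := leqP m n.
  by apply: (pg_opposition_graph G) f_inj f_dim f_surj dE => //; lia.
(* In the dual lattice the subspaces have dimension [n], and modularity turns [m] minus the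
   dimension of the intersection into [n] minus the codimension of the sum. *)
apply: (pg_opposition_graph (projective_geometry_dual G) _ _ f_inj) => //.
- by lia.
- by move=> W; rewrite f_dim; lia.
- move=> A dA; apply: f_surj.
  by have := pg_dim_bound G A; lia.
- move=> W1 W2; rewrite dE.
  have := pg_dim_mod G (f W1) (f W2).
  have := pg_dim_bound G (subsp_join (f W1) (f W2)).
  have := pg_dim_le G (pg_meetl G (f W1) (f W2)).
  by rewrite !f_dim; lia.
Qed.

Theorem theorem3p10 (D D' : unitRingType)
    (hD : division_ring D) (hD' : division_ring D')
    (m n p q : nat) (hm : 2 <= m) (hn : 2 <= n) (hp : 2 <= p) (hq : 2 <= q)
    (phi : grassmann D m (m + n) -> grassmann D' p (p + q))
    (phi_surj : forall B : grassmann D' p (p + q),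
       exists A : grassmann D m (m + n), phi A = B)
    (phi_diam : forall A B : grassmann D m (m + n),
       grassmann_dist A B = minn m n <->
       grassmann_dist (phi A) (phi B) = minn p q) :
  [/\ bijective phi,
      (forall A B : grassmann D m (m + n),
         adjacent A B -> adjacent (phi A) (phi B)),
      (forall psi : grassmann D' p (p + q) -> grassmann D m (m + n),
         cancel phi psi -> cancel psi phi ->
         forall A B : grassmann D' p (p + q),
           adjacent A B -> adjacent (psi A) (psi B))
    & minn m n = minn p q].
Proof.
have G := grassmann_opposition_graph hD hm hn.
have G' := grassmann_opposition_graph hD' hp hq.
have [psi psiK] := choice phi_surj.
(* Subspaces with the same image have the same opposites. *)
have phi_inj : injective phi.
  move=> A B eqAB; apply: contrapT => /(opposite_separated G)[X [XA []]].
  by apply/phi_diam; rewrite -eqAB; apply/phi_diam.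
have phiK : cancel phi psi by move=> A; apply: phi_inj.
have adj psi' : cancel phi psi' -> cancel psi' phi ->
    forall A B, adjacent A B -> adjacent (psi' A) (psi' B).
  move=> phiK' psiK'; apply: (opposition_adjacent G' G psiK' phiK') => A B.
  by rewrite phi_diam !psiK'.
have phi_adj := opposition_adjacent G G' phiK psiK phi_diam.
split=> //; first by exists psi.
(* Opposite pairs correspond, and neither [phi] nor [psi] increases distances, so each of the two
   minima bounds the other. *)
have [A [B AB]] := opposite_exists G; have [A' [B' AB']] := opposite_exists G'.
have := dist_nonincreasing G G' phi_adj A B.
have := dist_nonincreasing G' G (adj _ phiK psiK) A' B'.
rewrite AB' AB ((phi_diam _ _).1 AB).
rewrite ((phi_diam (psi A') (psi B')).2) ?psiK // => le1 le2.
by apply/anti_leq/andP.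
Qed.
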